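(* Let $a=0.19$ and $b=0.5095$, and define $f^+,f^-:[0,1]\to[0,1]$ by $f^-(x)=x$ and $f^+(x)=0$ if $x<a$, $f^+(x)=\left(\frac{x-a}{b-a}\right)^2$ if $x\in[a,b]$, $f^+(x)=1$ if $x\geq b$. Then on complete graphs, the pivot rounding algorithm with these rounding functions (applied to an optimal solution of the LP relaxation) gives a $(2.06-\varepsilon)$-approximation for the Correlation Clustering Problem, for some constant $\varepsilon$ with $0<\varepsilon<0.01$; that is, the expected cost of the clustering it outputs is at most $(2.06-\varepsilon)$ times the minimum cost.
   Context: Correlation Clustering on a complete graph: $V$ is a finite vertex set, each pair of distinct vertices is either a positive edge (set $E^+$) or a negative edge (set $E^-$). A clustering is a partition of $V$; its cost is the number of positive edges whose endpoints are in different parts plus the number of negative edges whose endpoints are in the same part. LP relaxation: variables $x_{uv}=x_{vu}\in[0,1]$ for all $u,v\in V$, with $x_{uu}=0$ and $x_{uv}+x_{vw}\ge x_{uw}$ for all $u,v,w\in V$; minimize $\sum_{(u,v)\in E^+}x_{uv}+\sum_{(u,v)\in E^-}(1-x_{uv})$. Pivot rounding algorithm with rounding functions $f^+,f^-$ (and a feasible LP solution $x$): set $V_0=V$, $t=0$. While $V_t\neq\emptyset$: choose a pivot $w\in V_t$ uniformly at random; for each $u\in V_t$ let $p_{uw}=f^+(x_{uw})$ if $(u,w)$ is a positive edge, $p_{uw}=f^-(x_{uw})$ if it is a negative edge, and $p_{ww}=0$; put each $u\in V_t$ into $S_t$ independently with probability $1-p_{uw}$; set $V_{t+1}=V_t\setminus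 S_t$ and $t\leftarrow t+1$. Output the sets $S_0,S_1,\dots$ as the clusters. *)

(* Defs.v *)
From HB Require Import structures.
From mathcomp Require Import all_boot all_order all_algebra.
From mathcomp Require Import reals.
Set Implicit Arguments. Unset Strict Implicit. Unset Printing Implicit Defensive.
Import Order.TTheory GRing.Theory Num.Theory.
Local Open Scope ring_scope.

Section CC.
Variable R : realType.
Variable V : finType.
(* positive edges of the complete graph on V; every other pair of distinct
   vertices is a negative edge *)
Variable pos : rel V.

Definition ind (b : bool) : R := if b then 1 else 0.

(* cost of a clustering given as a partition P of V (each unordered pair of
   distinct vertices counted once, hence the factor 1/2 on ordered pairs) *)
Definition cc_cost (P : {set {set V}}) : R :=
  2^-1 * \sum_(u : V) \sum_(v : V | v != u)
    (if pos u v then ind (pblock P u != pblock P v)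
     else ind (pblock P u == pblock P v)).

Definition lp_feasible (x : V -> V -> R) : Prop :=
  (forall u v, x u v = x v u) /\ (forall u, x u u = 0) /\
  (forall u v, 0 <= x u v <= 1) /\
  (forall u v w, x u w <= x u v + x v w).

Definition lp_obj (x : V -> V -> R) : R :=
  2^-1 * \sum_(u : V) \sum_(v : V | v != u)
    (if pos u v then x u v else 1 - x u v).

Definition lp_optimal (x : V -> V -> R) : Prop :=
  lp_feasible x /\ forall y, lp_feasible y -> lp_obj x <= lp_obj y.

Definition ra : R := 19%:R / 100%:R.
Definition rb : R := 5095%:R / 10000%:R.
Definition fplus (t : R) : R :=
  if t < ra then 0 else if t <= rb then ((t - ra) / (rb - ra)) ^+ 2 else 1.
Definition fminus (t : R) : R := t.

Variable x : V -> V -> R.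

(* p_{uw}: probability that u is NOT put in the cluster of pivot w *)
Definition pprob (u w : V) : R :=
  if u == w then 0 else if pos u w then fplus (x u w) else fminus (x u w).

(* cost incurred when cluster C is cut out of the remaining set S:
   negative edges inside C, positive edges between C and S \ C *)
Definition step_cost (S C : {set V}) : R :=
  2^-1 * (\sum_(u in C) \sum_(v in C | v != u) ind (~~ pos u v))
  + \sum_(u in C) \sum_(v in S :\: C) ind (pos u v).

(* expected cost of the clustering produced by the pivot rounding algorithm
   started on the remaining vertex set S (fuel k >= #|S|): the pivot w is
   uniform in S, the cluster C is a subset of S where each u in S is included
   independently with probability 1 - p_{uw} *)
Fixpoint pivot_ecost (k : nat) (S : {set V}) : R :=
  match k with
  | 0 => 0
  | k'.+1 =>
    if S == set0 then 0 else
    (#|S|%:R)^-1 * \sum_(w in S) \sum_(C in powerset S)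
      (\prod_(u in S) (if u \in C then 1 - pprob u w else pprob u w)) *
      (step_cost S C + pivot_ecost k' (S :\: C))
  end.

Definition pivot_expected_cost : R := pivot_ecost #|V| [set: V].
End CC.

(* Main.v *)
Require Import Defs.
From Stdlib Require Import ZArith Ring_polynom InitialRing.
From HB Require Import structures.
From mathcomp Require Import all_boot all_order all_algebra.
From mathcomp Require Import reals.
From mathcomp Require Import ring lra.
Set Implicit Arguments. Unset Strict Implicit. Unset Printing Implicit Defensive.
Import Order.TTheory GRing.Theory Num.Theory.
Local Open Scope ring_scope.
Delimit Scope Z_scope with Z.

(* Fix alpha = 2.059. For a pivot w and a pair {u, v} still present, compare the
   expected cost charged to {u, v} in one step with alpha times the expected LP
   value the step removes (the LP value of {u, v} when u or v is clustered). By
   linearity the theorem reduces to: summed over all triples (w, u, v) of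
   remaining vertices, alpha * LP - cost is nonnegative, and by symmetrization
   this is checked on each unordered triple separately. Degenerate triples only
   need f+(t) <= alpha t and 1 - f-(t) <= alpha (1 - t).

   For a triple of distinct vertices with LP lengths x >= y >= z, the domain
   {z <= y <= x <= 1, x <= y + z} is a simplex. It is cut along the breakpoints
   0.19 and 0.5095 of f+ for every positive edge; on each piece the slack is a
   polynomial, which is nonnegative as soon as its homogenization in barycentric
   coordinates has nonnegative coefficients. When it has not, the piece is
   bisected. This is carried out with exact integer arithmetic; the largest
   ratio cost / LP is about 2.0585. *)

(** * Exact integer checker for the triple inequality *)

Section Checker.
Local Open Scope Z_scope.

Notation zpol := (Pol Z).
Definition padd : zpol -> zpol -> zpol := Padd 0 Z.add Z.eqb.
Definition pmul : zpol -> zpol -> zpol := Pmul 0 1 Z.add Z.mul Z.eqb.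

(* Homogeneous coordinates of the point (vx / vw, vy / vw, vz / vw). *)
Record vec := Vec { vw : Z; vx : Z; vy : Z; vz : Z }.

Definition vcomb (k : Z) (u : vec) (l : Z) (v : vec) : vec :=
  Vec (k * vw u + l * vw v) (k * vx u + l * vx v)
      (k * vy u + l * vy v) (k * vz u + l * vz v).

Definition vscale (g : Z) (u : vec) : vec :=
  Vec (g * vw u) (g * vx u) (g * vy u) (g * vz u).

Definition vgcd (u : vec) : Z :=
  Z.gcd (Z.gcd (vw u) (vx u)) (Z.gcd (vy u) (vz u)).

(** Only keeps the integers small: [check] multiplies back and compares, so no property of gcd or
    division has to be proved. *)
Definition vdiv (u : vec) (g : Z) : vec :=
  Vec (vw u / g) (vx u / g) (vy u / g) (vz u / g).

Definition veqb (u v : vec) : bool :=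
  [&& vw u =? vw v, vx u =? vx v, vy u =? vy v & vz u =? vz v].

Record simplex := Simplex { va : vec; vb : vec; vc : vec; vd : vec }.

(* The linear form [f] in barycentric coordinates: [PX P 1 Q] is [P * X_1 + Q] with
   the variables of [Q] shifted by one. *)
Definition lin4 (f : vec -> Z) (D : simplex) : zpol :=
  PX (Pc (f (va D))) 1 (PX (Pc (f (vb D))) 1
    (PX (Pc (f (vc D))) 1 (PX (Pc (f (vd D))) 1 (Pc 0)))).

Fixpoint coefs_nonneg (P : zpol) : bool :=
  match P with
  | Pc c => 0 <=? c
  | Pinj _ Q => coefs_nonneg Q
  | PX P _ Q => coefs_nonneg P && coefs_nonneg Q
  end.

(* The pieces of f+ below, between and above its breakpoints, and the negative edges. *)
Inductive kind := Low | Mid | High | Neg.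

Definition all4 (p : vec -> bool) (D : simplex) : bool :=
  [&& p (va D), p (vb D), p (vc D) & p (vd D)].

(* The breakpoints are 0.19 = 380 / 2000 and 0.5095 = 1019 / 2000. *)
Definition above (K : Z) (f : vec -> Z) (v : vec) : Z := 2000 * f v - K * vw v.

Definition kind_ok (k : kind) (s : bool) (f : vec -> Z) (D : simplex) : bool :=
  match k with
  | Low => s && all4 (fun v => above 380 f v <=? 0) D
  | Mid => s && all4 (fun v => (0 <=? above 380 f v) && (above 1019 f v <=? 0)) D
  | High => s && all4 (fun v => 0 <=? above 1019 f v) D
  | Neg => ~~ s
  end.

(* The answer [Mid] is a guess, validated by [kind_ok]. *)
Definition find_kind (s : bool) (f : vec -> Z) (D : simplex) : kind :=
  if ~~ s then Neg
  else if all4 (fun v => above 380 f v <=? 0) D then Low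
  else if all4 (fun v => 0 <=? above 1019 f v) D then High
  else Mid.

(* Written over arbitrary operations, to be evaluated both on polynomials with
   integer coefficients and on reals. *)
Section Form.
Variables (T : Type) (add mul : T -> T -> T) (cst : Z -> T).
Notation "x +' y" := (add x y) (at level 50, left associativity).
Notation "x *' y" := (mul x y) (at level 40, left associativity).

(* [639^2 w^2] times the probability that an edge of length [x / w] is cut by the pivot;
   639 / 2000 = 0.5095 - 0.19. *)
Definition scaled_prob (k : kind) (w x : T) : T :=
  match k with
  | Low => cst 0
  | Mid => (x *' cst 2000 +' w *' cst (-380)) *' (x *' cst 2000 +' w *' cst (-380))
  | High => (w *' w) *' cst (639 * 639)
  | Neg => (w *' x) *' cst (639 * 639)
  end.

Definition is_neg (k : kind) : bool := if k is Neg then true else false.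
Definition elen (k : kind) (w x : T) : T :=
  if is_neg k then w +' x *' cst (-1) else x.
(** The expected cost of an edge is q + r - 2qr if positive and 1 - q - r + qr if negative. Its
    opposite contributes [sg] to the linear terms and, scaled by 1000, [m] to the product in
    [excess]. *)
Definition sg (k : kind) : Z := if is_neg k then 1 else -1.

(* [639^4 * 1000 w^5] times (alpha * LP - cost), grouped by monomials in the
   probabilities so that few polynomial products are needed. *)
Definition excess (k1 k2 k3 : kind) (w x y z : T) : T :=
  let n1 := scaled_prob k1 w x in
  let n2 := scaled_prob k2 w y in
  let n3 := scaled_prob k3 w z in
  let l1 := elen k1 w x in
  let l2 := elen k2 w y in
  let l3 := elen k3 w z in
  let m k := if is_neg k then -1000 else 2000 in
  let negs := (if is_neg k1 then 1 else 0) + (if is_neg k2 then 1 else 0)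
              + (if is_neg k3 then 1 else 0) in
  (w *' w *' w) *'
    (w *' ((l1 +' l2 +' l3) *' cst 2059 +' w *' cst (-1000 * negs))
       *' cst (639 * 639 * (639 * 639))
     +' (n1 *' cst (sg k2 + sg k3) +' n2 *' cst (sg k1 + sg k3)
         +' n3 *' cst (sg k1 + sg k2)) *' cst (1000 * (639 * 639)))
  +' (n2 *' n3) *' (w *' cst (m k1) +' l1 *' cst (-2059))
  +' (n1 *' n3) *' (w *' cst (m k2) +' l2 *' cst (-2059))
  +' (n1 *' n2) *' (w *' cst (m k3) +' l3 *' cst (-2059)).
End Form.

Definition leaf (s1 s2 s3 : bool) (D : simplex) : bool :=
  let k1 := find_kind s1 vx D in
  let k2 := find_kind s2 vy D in
  let k3 := find_kind s3 vz D in
  [&& kind_ok k1 s1 vx D, kind_ok k2 s2 vy D, kind_ok k3 s3 vz D &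
    coefs_nonneg (excess padd pmul (@Pc Z) k1 k2 k3
      (lin4 vw D) (lin4 vx D) (lin4 vy D) (lin4 vz D))].

(* The six edges, each brought to the first two positions. *)
Definition edge_orders (D : simplex) : list simplex :=
  let: Simplex a b c d := D in
  [:: Simplex a b c d; Simplex a c b d; Simplex a d b c;
      Simplex b c a d; Simplex b d a c; Simplex c d a b].

Definition straddles (h : vec -> Z) (D : simplex) : bool :=
  h (va D) * h (vb D) <? 0.

Fixpoint find_edge (h : vec -> Z) (l : list simplex) : option simplex :=
  match l with
  | nil => None
  | D :: l' => if straddles h D then Some D else find_edge h l'
  end.

(** The weights place the new vertex exactly on the plane, since [h] has opposite signs at the two
    ends. *)
Fixpoint find_cut (hs : list (vec -> Z)) (D : simplex) : option (simplex * Z * Z) :=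
  match hs with
  | nil => None
  | h :: hs' =>
    if find_edge h (edge_orders D) is Some D' then
      Some (D', Z.abs (h (vb D')), Z.abs (h (va D')))
    else find_cut hs' D
  end.

(* Cutting at 0.5095 before 0.19 gives markedly fewer pieces. *)
Definition planes (s1 s2 s3 : bool) : list (vec -> Z) :=
  flatten [seq (if s1 then [:: above K vx] else [::]) ++
    (if s2 then [:: above K vy] else [::]) ++
    (if s3 then [:: above K vz] else [::]) | K <- [:: 1019; 380]].

(* New vertices go last and bisection splits the first edge, so that the oldest edges
   are split first and the pieces do not degenerate. The inner [if] is not an [||],
   which call-by-value evaluation would unfold without end. *)
Fixpoint check (n : nat) (s1 s2 s3 : bool) (D : simplex) : bool :=
  let split (D : simplex) k l n' :=
    let M := vcomb k (va D) l (vb D) in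
    let g := vgcd M in
    let M' := vdiv M g in
    [&& 0 <? k, 0 <? l, 0 <? g, veqb (vscale g M') M,
      check n' s1 s2 s3 (Simplex (va D) (vc D) (vd D) M') &
      check n' s1 s2 s3 (Simplex (vb D) (vc D) (vd D) M')] in
  match n with
  | O => false
  | n'.+1 =>
    match find_cut (planes s1 s2 s3) D with
    | Some (D', k, l) => split D' k l n'
    | None =>
      if leaf s1 s2 s3 D then true else split D (vw (vb D)) (vw (va D)) n'
    end
  end.

(** The simplex z <= y <= x <= 1, x <= y + z; its last vertex (1, 1/2, 1/2) is doubled to be
    integral. *)
Definition sorted_triples : simplex :=
  Simplex (Vec 1 0 0 0) (Vec 1 1 1 1) (Vec 1 1 1 0) (Vec 2 2 1 1).

Lemma check_sorted_triples s1 s2 s3 : check 40 s1 s2 s3 sorted_triples = true.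
Proof. by case: s1; case: s2; case: s3; vm_compute. Qed.
End Checker.

(** * Evaluation of the integer polynomials over the reals *)

Section Soundness.
Variable R : realType.

Lemma R_ring_theory :
  ring_theory (0 : R) 1 (@GRing.add R) (@GRing.mul R)
    (fun x y => x - y) (@GRing.opp R) eq.
Proof.
split; [exact: add0r|exact: addrC|exact: addrA|exact: mul1r|exact: mulrC
  |exact: mulrA|exact: mulrDl|by []|exact: subrr].
Qed.

Definition z2r : Z -> R := gen_phiZ 0 1 (@GRing.add R) (@GRing.mul R) (@GRing.opp R).

Arguments z2r : simpl never.

Let eqR := Eqsth R.
Let extR := Eq_ext (@GRing.add R) (@GRing.mul R) (@GRing.opp R).
Let morphR := gen_phiZ_morph eqR extR R_ring_theory.
Let ARth := Rth_ARth eqR extR R_ring_theory.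

Lemma z2rD u v : z2r (u + v)%Z = z2r u + z2r v.
Proof. exact: (morph_add morphR). Qed.
Lemma z2rM u v : z2r (u * v)%Z = z2r u * z2r v.
Proof. exact: (morph_mul morphR). Qed.
Lemma z2rN u : z2r (- u)%Z = - z2r u.
Proof. exact: (morph_opp morphR). Qed.

Lemma z2r_pos p : 0 < z2r (Zpos p).
Proof.
rewrite /z2r /= -(same_gen eqR extR ARth).
by elim: p => [p IH|p IH|] /=; rewrite ?ltr01 // ?addr_gt0 ?mulr_gt0 ?addr_gt0.
Qed.

Lemma z2r_gt0 u : (0 <? u)%Z -> 0 < z2r u.
Proof. by case: u => // p _; exact: z2r_pos. Qed.

Lemma z2r_ge0 u : (0 <=? u)%Z -> 0 <= z2r u.
Proof. by case: u => // p _; exact/ltW/z2r_pos. Qed.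

Lemma z2r_le0 u : (u <=? 0)%Z -> z2r u <= 0.
Proof. by case: u => // p _; rewrite -[Z.neg p]/(- Z.pos p)%Z z2rN oppr_le0 ltW ?z2r_pos. Qed.

Lemma z2r_nat n : z2r (Z.of_nat n) = n%:R.
Proof. by elim: n => // n IH; rewrite Nat2Z.inj_succ -Z.add_1_r z2rD IH mulrS addrC. Qed.

Definition peval (l : list R) : Pol Z -> R :=
  Pphi 0 (@GRing.add R) (@GRing.mul R) z2r l.

Lemma pevalD l P Q : peval l (padd P Q) = peval l P + peval l Q.
Proof. exact: (Padd_ok eqR extR ARth morphR). Qed.
Lemma pevalM l P Q : peval l (pmul P Q) = peval l P * peval l Q.
Proof. exact: (Pmul_ok eqR extR ARth morphR). Qed.

Lemma pevalC l c : peval l (Pc c) = z2r c. Proof. by []. Qed.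

Definition nonneg (l : list R) := forall x, List.In x l -> 0 <= x.

Lemma nonneg_tl l : nonneg l -> nonneg (List.tl l).
Proof. by case: l => // x l H y Hy; apply: H; right. Qed.

Lemma nonneg_jump j l : nonneg l -> nonneg (BinList.jump j l).
Proof.
elim: j l => [j IH|j IH|] l H /=; last exact: nonneg_tl.
  by apply/IH/IH/nonneg_tl.
by apply/IH/IH.
Qed.

Lemma nonneg_pow (x : R) j : 0 <= x -> 0 <= pow_pos (@GRing.mul R) x j.
Proof. by move=> x0; elim: j => [j|j|] //= ?; rewrite !mulr_ge0. Qed.

Lemma coefs_nonneg_sound P l : coefs_nonneg P -> nonneg l -> 0 <= peval l P.
Proof.
elim: P l => [c|j Q IH|P IHP i Q IHQ] l /=; first by move=> /z2r_ge0.
  by move=> HQ Hl; apply: IH => //; exact: nonneg_jump.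
move=> /andP[HP HQ] Hl; apply: addr_ge0; last by apply: IHQ => //; exact: nonneg_tl.
apply: mulr_ge0; first exact: IHP.
(* Past the end of the list a variable takes the default 0, also nonnegative. *)
by apply: nonneg_pow; case: l Hl => //= x l Hl; apply: Hl; left.
Qed.

Definition comb (f : vec -> Z) (D : simplex) (a b c d : R) : R :=
  a * z2r (f (va D)) + b * z2r (f (vb D)) + c * z2r (f (vc D)) + d * z2r (f (vd D)).

(** The weights are not normalized, so vertices may be rescaled freely; [w] is set to 1 only when
    the slack is read off. *)
Definition in_cone (D : simplex) (w x y z : R) : Prop :=
  exists a b c d : R, [/\ 0 <= a, 0 <= b, 0 <= c & 0 <= d] /\
  [/\ w = comb vw D a b c d, x = comb vx D a b c d,
      y = comb vy D a b c d & z = comb vz D a b c d].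

Lemma lin4E f D a b c d : peval [:: a; b; c; d] (lin4 f D) = comb f D a b c d.
Proof.
suff H (p q r s : R) : p * a + (q * b + (r * c + (s * d + 0)))
    = a * p + b * q + c * r + d * s by exact: H.
by ring.
Qed.

(** Parametricity of [excess]: it links the polynomial computed by the checker to the real form. *)
Lemma excess_morph T (add mul : T -> T -> T) cst (h : T -> R) :
  (forall u v, h (add u v) = h u + h v) -> (forall u v, h (mul u v) = h u * h v) ->
  (forall c, h (cst c) = z2r c) -> forall k1 k2 k3 w x y z,
  h (excess add mul cst k1 k2 k3 w x y z)
    = excess +%R *%R z2r k1 k2 k3 (h w) (h x) (h y) (h z).
Proof.
move=> hD hM hc k1 k2 k3 w x y z.
have hp k u : h (scaled_prob add mul cst k w u) = scaled_prob +%R *%R z2r k (h w) (h u).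
  by case: k => /=; rewrite !(hD, hM, hc).
have hl k u : h (elen add mul cst k w u) = elen +%R *%R z2r k (h w) (h u).
  by rewrite /elen; case: (is_neg k); rewrite ?(hD, hM, hc).
by rewrite /excess; do !rewrite (hD, hM, hc, hp, hl).
Qed.

(** The pieces are closed and share their breakpoints, which is consistent because f+ is
    continuous. *)
Definition kind_at (k : kind) (s : bool) (t : R) : Prop :=
  match k with
  | Low => s /\ t <= ra R
  | Mid => s /\ ra R <= t <= rb R
  | High => s /\ rb R <= t
  | Neg => s = false
  end.

Lemma all4_comb (p : vec -> bool) D f a b c d :
  (forall v, p v -> 0 <= z2r (f v)) ->
  [/\ 0 <= a, 0 <= b, 0 <= c & 0 <= d] ->
  all4 p D -> 0 <= comb f D a b c d.
Proof.
move=> H [ha hb hc hd] /and4P[/H ? /H ? /H ? /H ?].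
by rewrite /comb !addr_ge0 // mulr_ge0.
Qed.

Lemma comb_above K f D a b c d :
  comb (above K f) D a b c d
    = z2r 2000 * comb f D a b c d - z2r K * comb vw D a b c d.
Proof. by rewrite /comb /above -!Z.add_opp_r !z2rD !z2rN !z2rM; ring. Qed.

Lemma comb_opp f D a b c d :
  comb (fun v => - f v)%Z D a b c d = - comb f D a b c d.
Proof. by rewrite /comb !z2rN; ring. Qed.


(** * Slack of a triple and soundness of the checker *)

Definition prob (s : bool) (t : R) : R := if s then fplus t else t.
(** [q] and [r] are the probabilities that each endpoint stays outside the cluster: a positive edge
    pays when exactly one is taken, a negative edge when both are. *)
Definition ecost (s : bool) (q r : R) : R :=
  if s then q * (1 - r) + r * (1 - q) else (1 - q) * (1 - r).
Definition elp (s : bool) (q r t : R) : R := (1 - q * r) * (if s then t else 1 - t).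
Definition alpha : R := 2059%:R / 1000%:R.
Definition slack (s : bool) (q r t : R) : R := alpha * elp s q r t - ecost s q r.
(** Each edge is judged with the opposite vertex as pivot, so its endpoints are left out according
    to the other two edges. *)
Definition triple_slack (s1 s2 s3 : bool) (x y z : R) : R :=
  slack s1 (prob s2 y) (prob s3 z) x + slack s2 (prob s3 z) (prob s1 x) y
  + slack s3 (prob s1 x) (prob s2 y) z.

Lemma kind_sign k s t : kind_at k s t -> s = ~~ is_neg k.
Proof. by case: k => //= -[]. Qed.

Lemma scaled_probE k s t : kind_at k s t ->
  scaled_prob +%R *%R z2r k 1 t = z2r (639 * 639) * prob s t.
Proof.
have h2000 : z2r 2000 = 2000%:R by rewrite -[2000%Z]/(Z.of_nat 2000) z2r_nat.
have h380 : z2r (-380) = - 380%:R by rewrite -[(-380)%Z]/(- Z.of_nat 380)%Z z2rN z2r_nat.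
have h639 : z2r (639 * 639) = 639%:R * 639%:R by rewrite z2rM -[639%Z]/(Z.of_nat 639) z2r_nat.
have dba : rb R - ra R = 639%:R / 2000%:R by rewrite /rb /ra; lra.
have ab : ra R < rb R by rewrite -subr_gt0 dba divr_gt0 ?ltr0n.
have at_a : fplus (ra R) = 0 by rewrite /fplus ltxx ltW // subrr mul0r expr0n.
have at_b : fplus (rb R) = 1.
  by rewrite /fplus ltNge (ltW ab) lexx divff ?expr1n // subr_eq0 gt_eqF.
case: k => /= [[-> tle]|[-> /andP[tge tle]]|[-> tge]|->]; rewrite /prob.
- have -> : fplus t = 0.
    by move: tle; rewrite le_eqVlt => /predU1P[->//|lt_ta]; rewrite /fplus lt_ta.
  by rewrite mulr0.
- by rewrite /fplus ltNge tge /= tle dba h2000 h380 h639 /ra; field.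
- have -> : fplus t = 1.
    move: tge; rewrite le_eqVlt => /predU1P[<-//|lt_bt].
    by rewrite /fplus ltNge (ltW (lt_trans ab lt_bt)) /= leNgt lt_bt.
  by rewrite !mul1r mulr1.
- by rewrite mul1r mulrC.
Qed.

Lemma excessE k1 k2 k3 s1 s2 s3 x y z :
  kind_at k1 s1 x -> kind_at k2 s2 y -> kind_at k3 s3 z ->
  excess +%R *%R z2r k1 k2 k3 1 x y z
    = z2r (639 * 639) ^+ 2 * 1000%:R * triple_slack s1 s2 s3 x y z.
Proof.
move=> h1 h2 h3; rewrite /excess (scaled_probE h1) (scaled_probE h2) (scaled_probE h3).
rewrite /triple_slack (kind_sign h1) (kind_sign h2) (kind_sign h3) /slack.
move: (prob _ x) (prob _ y) (prob _ z) => p1 p2 p3.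
have h2059 : z2r 2059 = 2059%:R by rewrite -[2059%Z]/(Z.of_nat 2059) z2r_nat.
have h1000 : z2r 1000 = 1000%:R by rewrite -[1000%Z]/(Z.of_nat 1000) z2r_nat.
have h2059N : z2r (-2059) = - 2059%:R by rewrite -h2059 -z2rN.
have h1000N : z2r (-1000) = - 1000%:R by rewrite -h1000 -z2rN.
have h2000 : z2r 2000 = 1000%:R + 1000%:R by rewrite -h1000 -z2rD.
have z0 : z2r 0 = 0 by [].
have z1 : z2r 1 = 1 by [].
have z1N : z2r (-1) = - 1 by rewrite -z1 -z2rN.
rewrite /alpha /elp /ecost /elen /sg !(z2rM, z2rD) h2059 h1000 h2059N h1000N.
move: h1000N h2000 (pnatr_eq0 R 1000) {h2059 h1000 h2059N}.
(* Abstracting the constants spares [field] the large numerals; [m0] serves the denominator of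
   [alpha]. *)
move: (z2r 639) (2059%:R : R) (1000%:R : R) => e c m h1000N h2000 /negbT m0.
by case: (is_neg k1); case: (is_neg k2); case: (is_neg k3);
  rewrite /= ?(h1000N, z0, z1, z1N, h2000); field.
Qed.

(** The breakpoint conditions are linear, so they pass from the vertices to nonnegative
    combinations. *)
Lemma kind_sound k s f D a b c d :
  [/\ 0 <= a, 0 <= b, 0 <= c & 0 <= d] -> comb vw D a b c d = 1 ->
  kind_ok k s f D -> kind_at k s (comb f D a b c d).
Proof.
move=> nn w1.
have ge K : all4 (fun v => 0 <=? above K f v)%Z D -> z2r K <= z2r 2000 * comb f D a b c d.
  move=> /(all4_comb (f := above K f) (fun v => @z2r_ge0 _) nn).
  by rewrite comb_above w1 mulr1 subr_ge0.
have le K : all4 (fun v => above K f v <=? 0)%Z D -> z2r 2000 * comb f D a b c d <= z2r K.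
  have H v : (above K f v <=? 0)%Z -> 0 <= z2r (- above K f v).
    by move=> /z2r_le0; rewrite z2rN oppr_ge0.
  move=> /(all4_comb (f := fun v => (- above K f v)%Z) H nn).
  by rewrite comb_opp comb_above w1 mulr1 oppr_ge0 subr_le0.
have p0 := z2r_pos 2000.
have h2000 : z2r 2000 = 2000%:R by rewrite -[2000%Z]/(Z.of_nat 2000) z2r_nat.
have ra_z : ra R = z2r 380 / z2r 2000.
  by rewrite h2000 -[380%Z]/(Z.of_nat 380) z2r_nat /ra; field.
have rb_z : rb R = z2r 1019 / z2r 2000.
  by rewrite h2000 -[1019%Z]/(Z.of_nat 1019) z2r_nat /rb; field.
rewrite /kind_at ra_z rb_z !ler_pdivlMr // !ler_pdivrMr // ![comb f _ _ _ _ _ * _]mulrC.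
case: k => /=.
- by case/andP=> -> /le.
- case/andP=> -> /and4P[/andP[a1 a2] /andP[b1 b2] /andP[c1 c2] /andP[d1 d2]].
  by split=> //; apply/andP; split; [apply: ge|apply: le]; apply/and4P.
- by case/andP=> -> /ge.
- by case: s.
Qed.

Lemma leaf_sound s1 s2 s3 D x y z :
  leaf s1 s2 s3 D -> in_cone D 1 x y z -> 0 <= triple_slack s1 s2 s3 x y z.
Proof.
case/and4P=> k1 k2 k3 pos [a [b [c [d [nn [w1 -> -> ->]]]]]].
have {}k1 := kind_sound nn (esym w1) k1.
have {}k2 := kind_sound nn (esym w1) k2.
have {}k3 := kind_sound nn (esym w1) k3.
have l0 : nonneg [:: a; b; c; d].
  by move=> u /=; case: nn => ? ? ? ? [<-|[<-|[<-|[<-|]]]].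
have := coefs_nonneg_sound pos l0.
rewrite (excess_morph (pevalD _) (pevalM _) (pevalC _)) !lin4E -w1 (excessE k1 k2 k3).
rewrite pmulr_rge0 // mulr_gt0 ?ltr0n // exprn_gt0 //; exact: z2r_pos.
Qed.

(** With gM = kA + lB, a combination aA + bB can trade A for M when a/k <= b/l, and B for M
    otherwise, keeping nonnegative weights. *)
Lemma split_sound k l g D M w x y z :
  (0 <? k)%Z -> (0 <? l)%Z -> (0 <? g)%Z ->
  veqb (vscale g M) (vcomb k (va D) l (vb D)) -> in_cone D w x y z ->
  in_cone (Simplex (va D) (vc D) (vd D) M) w x y z \/
  in_cone (Simplex (vb D) (vc D) (vd D) M) w x y z.
Proof.
move=> /z2r_gt0 k0 /z2r_gt0 l0 /z2r_gt0 g0 /and4P[].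
rewrite /= => /Z.eqb_eq /(congr1 z2r) ew /Z.eqb_eq /(congr1 z2r) ex.
move=> /Z.eqb_eq /(congr1 z2r) ey /Z.eqb_eq /(congr1 z2r) ez.
rewrite !z2rD !z2rM in ew ex ey ez.
case=> a [b [c [d [[a0 b0 c0 d0] [-> -> -> ->]]]]].
have kn := lt0r_neq0 k0; have ln := lt0r_neq0 l0; have gn := lt0r_neq0 g0.
case: (leP (a * z2r l) (b * z2r k)) => [h|/ltW h]; [right|left].
  exists (b - a * z2r l / z2r k), c, d, (a * z2r g / z2r k); split.
    by split=> //; rewrite ?subr_ge0 ?ler_pdivrMr // !mulr_ge0 // ?invr_ge0 ltW.
  have E A B C E M' : z2r g * M' = z2r k * A + z2r l * B ->
    a * A + b * B + c * C + d * E
      = (b - a * z2r l / z2r k) * B + c * C + d * E + a * z2r g / z2r k * M'.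
    move=> e; have -> : M' = (z2r k * A + z2r l * B) / z2r g by rewrite -e; field.
    by field; rewrite kn gn.
  by split; rewrite /comb /=; apply: E.
exists (a - b * z2r k / z2r l), c, d, (b * z2r g / z2r l); split.
  by split=> //; rewrite ?subr_ge0 ?ler_pdivrMr // !mulr_ge0 // ?invr_ge0 ltW.
have E A B C E M' : z2r g * M' = z2r k * A + z2r l * B ->
  a * A + b * B + c * C + d * E
    = (a - b * z2r k / z2r l) * A + c * C + d * E + b * z2r g / z2r l * M'.
  move=> e; have -> : M' = (z2r k * A + z2r l * B) / z2r g by rewrite -e; field.
  by field; rewrite ln gn.
by split; rewrite /comb /=; apply: E.
Qed.

Lemma edge_orders_sound D D' w x y z :
  List.In D' (edge_orders D) -> in_cone D w x y z -> in_cone D' w x y z.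
Proof.
case: D => A B C E /= D'in [a [b [c [d [[a0 b0 c0 d0] [-> -> -> ->]]]]]].
case: D'in => [<-|[<-|[<-|[<-|[<-|[<-|[]]]]]]].
- by exists a, b, c, d.
- by exists a, c, b, d; split=> //; split; rewrite /comb /=; ring.
- by exists a, d, b, c; split=> //; split; rewrite /comb /=; ring.
- by exists b, c, a, d; split=> //; split; rewrite /comb /=; ring.
- by exists b, d, a, c; split=> //; split; rewrite /comb /=; ring.
- by exists c, d, a, b; split=> //; split; rewrite /comb /=; ring.
Qed.

Lemma find_edge_in h l D : find_edge h l = Some D -> List.In D l.
Proof.
by elim: l => //= D' l IH; case: ifP => _ => [[->]|/IH]; [left|right].
Qed.

Lemma find_cut_in hs D D' k l : find_cut hs D = Some (D', k, l) -> List.In D' (edge_orders D).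
Proof.
elim: hs => //= h hs IH; case eqe: (find_edge h (edge_orders D)) => [D''|] //.
by case=> <- _ _; exact: find_edge_in eqe.
Qed.

Lemma check_sound n s1 s2 s3 D x y z :
  check n s1 s2 s3 D -> in_cone D 1 x y z -> 0 <= triple_slack s1 s2 s3 x y z.
Proof.
elim: n D => // n IH D /=.
case eqc: (find_cut _ D) => [[[D' k] l]|].
  move=> /and5P[k0 l0 g0 e /andP[/IH c1 /IH c2]] /(edge_orders_sound (find_cut_in eqc)).
  by case/(split_sound k0 l0 g0 e).
case: ifP => [lf _|_]; first exact: leaf_sound lf.
move=> /and5P[k0 l0 g0 e /andP[/IH c1 /IH c2]].
by case/(split_sound k0 l0 g0 e).
Qed.

Lemma triple_slack_sorted s1 s2 s3 x y z :
  z <= y -> y <= x -> x <= 1 -> x <= y + z -> 0 <= triple_slack s1 s2 s3 x y z.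
Proof.
move=> zy yx x1 tri; apply: check_sound (check_sorted_triples s1 s2 s3) _.
(* The weights are the slacks of the four facet inequalities. *)
exists (1 - x), (y + z - x), (y - z), (x - y); split.
  by split; rewrite subr_ge0.
have [z0 z1 z2] : [/\ z2r 0 = 0, z2r 1 = 1 & z2r 2 = 1 + 1] by [].
by split; rewrite /comb /= ?z2 ?z1 ?z0; ring.
Qed.

Lemma triple_slackC s1 s2 s3 x y z :
  triple_slack s1 s2 s3 x y z = triple_slack s1 s3 s2 x z y.
Proof.
have sC s q r t : slack s q r t = slack s r q t.
  by rewrite /slack /elp /ecost; case: s; ring.
by rewrite /triple_slack (sC s1) (sC s2) (sC s3) addrAC.
Qed.

Lemma triple_slack_rot s1 s2 s3 x y z :
  triple_slack s1 s2 s3 x y z = triple_slack s2 s3 s1 y z x.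
Proof. by rewrite /triple_slack -addrA addrC. Qed.

(** Swaps and rotations of the edges preserve the slack, so the lengths can be sorted. *)
Lemma triple_slack_ge0 s1 s2 s3 x y z :
  x <= 1 -> y <= 1 -> z <= 1 -> x <= y + z -> y <= x + z -> z <= x + y ->
  0 <= triple_slack s1 s2 s3 x y z.
Proof.
wlog zy : s1 s2 s3 x y z / z <= y.
  move=> H x1 y1 z1 tx ty tz; case: (leP z y) => [/H -> //|/ltW /H].
  by rewrite triple_slackC; apply; rewrite // addrC.
case: (leP y x) => yx.
  by move=> *; exact: triple_slack_sorted.
have {}yx := ltW yx.
move=> x1 y1 z1 tx ty tz; rewrite triple_slack_rot.
case: (leP z x) => zx.
  by rewrite triple_slackC; apply: triple_slack_sorted; rewrite // addrC.
by apply: triple_slack_sorted; rewrite 1?addrC // ltW.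
Qed.
End Soundness.

(** * Bounds on the rounding functions and degenerate triples *)

Section RoundingFunctions.
Variable R : realType.

Lemma fplus_bounds (t : R) : 0 <= t ->
  [/\ 0 <= fplus t, fplus t <= 1 & fplus t <= alpha R * t].
Proof.
move=> t0.
have dba : rb R - ra R = 639%:R / 2000%:R by rewrite /rb /ra; field.
have dpos : 0 < rb R - ra R by rewrite dba divr_gt0 ?ltr0n.
have al : 2 <= alpha R by rewrite /alpha ler_pdivlMr ?ltr0n // -natrM ler_nat.
rewrite /fplus; case: (ltP t (ra R)) => ta.
  by split=> //; rewrite mulr_ge0 //; apply: le_trans al; rewrite ler0n.
case: (leP t (rb R)) => tb; last first.
  split=> //; have : rb R < t by [].
  have : 1 <= alpha R * rb R by rewrite /alpha /rb; lra.
  move=> h1 h2; apply: le_trans h1 _; rewrite ler_wpM2l ?(le_trans _ al) ?ler0n //; exact: ltW.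
set q := (t - ra R) / (rb R - ra R).
have q0 : 0 <= q by apply: divr_ge0; [rewrite subr_ge0|exact: ltW].
have q1 : q <= 1 by rewrite ler_pdivrMr // mul1r lerD2r.
have tE : t = ra R + q * (rb R - ra R) by rewrite /q divfK ?gt_eqF //; ring.
split; [by rewrite exprn_ge0|by rewrite exprn_ile1|].
(* Replacing the square by [q] leaves an inequality linear in [q] on [0, 1]. *)
have qq : q ^+ 2 <= q by rewrite expr2 ler_piMr.
apply: le_trans qq _; rewrite tE dba /ra /alpha; lra.
Qed.

Lemma prob_bounds s (t : R) : 0 <= t <= 1 -> 0 <= prob s t <= 1.
Proof.
by move=> /andP[t0 t1]; case: s; rewrite /= ?t0 //; have [-> ->] := fplus_bounds t0.
Qed.

(** The 0 stands for an endpoint that is the pivot itself. *)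
Lemma slack_pivot s (t : R) : 0 <= t <= 1 -> 0 <= slack s 0 (prob s t) t.
Proof.
move=> /andP[t0 t1]; rewrite /slack /elp /ecost; case: s => /=.
  by have [_ _ h] := fplus_bounds t0; lra.
have : 1 <= alpha R by rewrite /alpha ler_pdivlMr ?ltr0n // mul1r ler_nat.
nra.
Qed.

Lemma slackC s (q r t : R) : slack s q r t = slack s r q t.
Proof. by rewrite /slack /elp /ecost; case: s; ring. Qed.
End RoundingFunctions.

(** * Moments of a random subset with independent memberships *)

Section Expectation.
Variables (R : comNzRingType) (V : finType).

Definition inclusion_weight (S : {set V}) (p : V -> R) (C : {set V}) : R :=
  \prod_(u in S) (if u \in C then 1 - p u else p u).

Lemma expect_inclusion (S T : {set V}) (p : V -> R) : T \subset S ->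
  \sum_(C in powerset S) inclusion_weight S p C * (T \subset C)%:R
    = \prod_(u in T) (1 - p u).
Proof.
(* Zero exclusion weight on [T] kills every [C] not containing [T], absorbing the indicator. *)
move=> TS; pose q u := if u \in T then 0 else p u.
transitivity (\sum_(C in powerset S)
    \prod_(u in S) (if u \in C then 1 - p u else q u)).
  apply: eq_bigr => C; rewrite inE => CS; rewrite /inclusion_weight.
  case: (boolP (T \subset C)) => [TC|/subsetPn[u uT uC]].
    rewrite mulr1; apply: eq_bigr => u _; rewrite /q.
    by case: ifP => // /negbT uC; case: ifP => // /(subsetP TC); rewrite (negbTE uC).
  by rewrite mulr0 (bigD1 u) ?(subsetP TS) //= (negbTE uC) /q uT mul0r.
(* Extended by 0 and 1 outside [S], the sum runs over all subsets of [V] and factors into the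
   product of [f + g], which is 1 off [T]. *)
pose f u := if u \in S then 1 - p u else 0.
pose g u := if u \in S then q u else 1.
transitivity (\sum_(C in {set V}) \prod_u (if u \in C then f u else g u)).
  rewrite [RHS](bigID (mem (powerset S))) /= [X in _ + X]big1 ?addr0; last first.
    move=> C; rewrite inE => /subsetPn[u uC uS].
    by rewrite (bigD1 u) //= uC /f (negbTE uS) mul0r.
  apply: eq_bigr => C; rewrite inE => CS.
  rewrite [RHS](bigID (mem S)) /= [X in _ * X]big1 ?mulr1; last first.
    move=> u uS; rewrite ifN ?/g ?(negbTE uS) //.
    by apply: contra uS; exact: (subsetP CS).
  by apply: eq_bigr => u uS; rewrite /f /g uS.
rewrite -(bigA_distr _ _ f g).
rewrite (bigID (mem T)) /= [X in _ * X]big1 ?mulr1; last first.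
  by move=> u uT; rewrite /f /g /q (negbTE uT); case: ifP; rewrite ?subrK ?add0r.
by apply: eq_bigr => u uT; rewrite /f /g (subsetP TS) // /q uT addr0.
Qed.

Lemma expect1 (S : {set V}) (p : V -> R) :
  \sum_(C in powerset S) inclusion_weight S p C = 1.
Proof.
have := expect_inclusion p (sub0set S); rewrite big_set0 => <-.
by apply: eq_bigr => C _; rewrite sub0set mulr1.
Qed.

Lemma expect_mem (S : {set V}) (p : V -> R) u : u \in S ->
  \sum_(C in powerset S) inclusion_weight S p C * (u \in C)%:R = 1 - p u.
Proof.
rewrite -sub1set => uS; have := expect_inclusion p uS; rewrite big_set1 => <-.
by apply: eq_bigr => C _; rewrite sub1set.
Qed.

Lemma expect_mem2 (S : {set V}) (p : V -> R) u v :
  u \in S -> v \in S -> v != u ->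
  \sum_(C in powerset S) inclusion_weight S p C * ((u \in C)%:R * (v \in C)%:R)
    = (1 - p u) * (1 - p v).
Proof.
move=> uS vS vu; have uvS : [set u; v] \subset S by rewrite subUset !sub1set uS.
have := expect_inclusion p uvS; rewrite big_setU1 ?inE 1?eq_sym //= big_set1 => <-.
by apply: eq_bigr => C _; rewrite subUset !sub1set -natrM mulnb.
Qed.
End Expectation.

(** * Amortized analysis of the pivot algorithm *)

Section Pivot.
Variables (R : realType) (V : finType) (pos : rel V) (x : V -> V -> R).
Hypotheses (pos_sym : symmetric pos) (x_feas : lp_feasible x).

Let x_sym u v : x u v = x v u. Proof. by case: x_feas. Qed.
Let x_bnd u v : 0 <= x u v <= 1. Proof. by case: x_feas => _ [_ []]. Qed.
Let x_tri u v w : x u w <= x u v + x v w. Proof. by case: x_feas => _ [_ []]. Qed.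

Let p w u : R := pprob pos x u w.

Let pE w u : u != w -> p w u = prob (pos u w) (x u w).
Proof. by rewrite /p /pprob /prob /fminus => /negbTE->. Qed.

Let pww w : p w w = 0. Proof. by rewrite /p /pprob eqxx. Qed.

Let p_bnd w u : 0 <= p w u <= 1.
Proof.
by case: (eqVneq u w) => [->|/pE->]; rewrite ?pww ?lexx ?ler01 // prob_bounds.
Qed.

Definition lp_edge u v : R := if pos u v then x u v else 1 - x u v.
Definition lp_on (S : {set V}) : R :=
  2^-1 * \sum_(u in S) \sum_(v in S | v != u) lp_edge u v.

Let lp_edge_ge0 u v : 0 <= lp_edge u v.
Proof. by rewrite /lp_edge; have /andP[? ?] := x_bnd u v; case: ifP; rewrite ?subr_ge0. Qed.

Lemma lp_on_ge0 S : 0 <= lp_on S.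
Proof.
rewrite mulr_ge0 ?invr_ge0 ?ler0n //.
by apply: sumr_ge0 => u _; apply: sumr_ge0 => v _.
Qed.

Definition pair_slack w u v : R :=
  if v == u then 0 else slack (pos u v) (p w u) (p w v) (x u v).

Lemma pair_slack_pivotl u v : 0 <= pair_slack u u v.
Proof.
rewrite /pair_slack; case: eqVneq => // vu.
by rewrite pww pE // pos_sym x_sym slack_pivot.
Qed.

Lemma pair_slack_pivotr u v : 0 <= pair_slack v u v.
Proof.
rewrite /pair_slack; case: eqVneq => // vu.
by rewrite pww pE 1?eq_sym // slackC slack_pivot.
Qed.

(** For distinct vertices this is [triple_slack]; if two coincide, one term vanishes and in the
    others the pivot is an endpoint. *)
Lemma pair_slack_cycle w u v :
  0 <= pair_slack w u v + pair_slack u v w + pair_slack v w u.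
Proof.
have d a b : pair_slack a b b = 0 by rewrite /pair_slack eqxx.
case: (eqVneq w u) => [->|wu].
  by rewrite d addr0 addr_ge0 ?pair_slack_pivotl ?pair_slack_pivotr.
case: (eqVneq v u) => [->|vu].
  by rewrite d add0r addr_ge0 ?pair_slack_pivotl ?pair_slack_pivotr.
case: (eqVneq w v) => [->|wv].
  by rewrite d addr0 addr_ge0 ?pair_slack_pivotl ?pair_slack_pivotr.
have := @triple_slack_ge0 R (pos u v) (pos v w) (pos w u) (x u v) (x v w) (x w u).
have b1 u' v' : x u' v' <= 1 by case/andP: (x_bnd u' v').
move=> /(_ (b1 _ _) (b1 _ _) (b1 _ _)).
have t1 : x u v <= x v w + x w u by rewrite addrC (x_sym v) (x_sym w u).
have t2 : x v w <= x u v + x w u by rewrite (x_sym u) (x_sym w).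
have t3 : x w u <= x u v + x v w by rewrite addrC (x_sym u) (x_sym v w).
have [uw uv vw] : [/\ u != w, u != v & v != w] by split; rewrite eq_sym.
move=> /(_ t1 t2 t3); rewrite /triple_slack /pair_slack.
rewrite (negbTE vu) (negbTE wv) (negbTE uw) !pE //.
rewrite slackC (slackC (pos v w)) (slackC (pos w u)).
by rewrite (pos_sym u w) (pos_sym w v) (pos_sym v u) (x_sym u w) (x_sym w v) (x_sym v u).
Qed.

(** Rotating the summation indices turns three times the sum into a sum of cyclic sums. *)
Lemma sum_pair_slack_ge0 (S : {set V}) :
  0 <= \sum_(w in S) \sum_(u in S) \sum_(v in S) pair_slack w u v.
Proof.
set Z := \sum_(w in S) _.
have Z1 : Z = \sum_(w in S) \sum_(u in S) \sum_(v in S) pair_slack u v w.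
  rewrite /Z; under eq_bigr => w _ do rewrite exchange_big.
  exact: exchange_big.
have Z2 : Z = \sum_(w in S) \sum_(u in S) \sum_(v in S) pair_slack v w u.
  by rewrite /Z [LHS]exchange_big; apply: eq_bigr => u _; exact: exchange_big.
suff : 0 <= Z + Z + Z by lra.
rewrite {2}Z1 {2}Z2 -!big_split; apply: sumr_ge0 => w _.
rewrite -!big_split; apply: sumr_ge0 => u _; rewrite -!big_split.
by apply: sumr_ge0 => v _; exact: pair_slack_cycle.
Qed.

(* Coefficients of (cost of a step) - alpha * (LP value it removes), as a polynomial in
   the membership indicators of the two endpoints. *)
Definition cut_coef u v : R := ind R (pos u v) - alpha R * lp_edge u v.
Definition join_coef u v : R :=
  ind R (~~ pos u v) - ind R (pos u v) *+ 2 + alpha R * lp_edge u v.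

Lemma step_balance (S C : {set V}) : C \subset S ->
  step_cost R pos S C + alpha R * lp_on (S :\: C) = alpha R * lp_on S +
  2^-1 * \sum_(u in S) \sum_(v in S | v != u)
    (cut_coef u v * ((u \in C)%:R + (v \in C)%:R)
     + join_coef u v * ((u \in C)%:R * (v \in C)%:R)).
Proof.
move=> CS.
have full (A B : {set V}) (F : V -> V -> R) :
    \sum_(u in A) \sum_(v in B | v != u) F u v
    = \sum_u \sum_v (if [&& u \in A, v \in B & v != u] then F u v else 0).
  rewrite big_mkcond; apply: eq_bigr => u _; case: (u \in A).
    by rewrite big_mkcond.
  by rewrite big1.
(* [step_cost] counts a cut pair once, from its clustered end; symmetrizing brings it under the
   common factor 1/2. *)
pose h u v : R := if (u \in C) && (v \in S :\: C) then ind R (pos u v) else 0.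
have cutE : \sum_(u in C) \sum_(v in S :\: C) ind R (pos u v)
    = 2^-1 * \sum_u \sum_v (h u v + h v u).
  have E : \sum_(u in C) \sum_(v in S :\: C) ind R (pos u v) = \sum_u \sum_v h u v.
    rewrite big_mkcond; apply: eq_bigr => u _; rewrite /h; case: (u \in C).
      by rewrite big_mkcond.
    by rewrite big1.
  rewrite E; under [in RHS]eq_bigr => u _ do rewrite big_split.
  by rewrite big_split /= [X in _ + X]exchange_big /=; field.
rewrite /step_cost cutE /lp_on !full -mulrDr ![alpha R * (2^-1 * _)]mulrCA -!mulrDr.
congr (_ * _); rewrite !mulr_sumr -!big_split; apply: eq_bigr => u _.
rewrite !mulr_sumr -!big_split; apply: eq_bigr => v _ /=.
rewrite /h !inE /cut_coef /join_coef /ind (pos_sym v u).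
have uCS := subsetP CS u; have vCS := subsetP CS v.
case: (eqVneq v u) => [->|vu]; first by case: (u \in C); rewrite /= ?andbF; ring.
case: (boolP (u \in C)) => [/uCS uS|uC]; case: (boolP (v \in C)) => [/vCS vS|vC];
  rewrite ?uS ?vS /=; try case: (u \in S); try case: (v \in S);
  case: (pos u v) => /=; ring.
Qed.

(** By linearity, the first and second moments of the membership indicators suffice. *)
Lemma expected_step (S : {set V}) w : w \in S ->
  \sum_(C in powerset S) inclusion_weight S (p w) C *
      (step_cost R pos S C + alpha R * lp_on (S :\: C))
    = alpha R * lp_on S - 2^-1 * \sum_(u in S) \sum_(v in S) pair_slack w u v.
Proof.
move=> wS.
transitivity (\sum_(C in powerset S) (inclusion_weight S (p w) C * (alpha R * lp_on S)
  + 2^-1 * \sum_(u in S) \sum_(v in S | v != u)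
    (cut_coef u v * (inclusion_weight S (p w) C * (u \in C)%:R
                     + inclusion_weight S (p w) C * (v \in C)%:R)
     + join_coef u v * (inclusion_weight S (p w) C * ((u \in C)%:R * (v \in C)%:R))))).
  apply: eq_bigr => C; rewrite inE => CS; rewrite (step_balance CS) mulrDr; congr (_ + _).
  rewrite mulrCA; congr (_ * _); rewrite mulr_sumr; apply: eq_bigr => u _.
  by rewrite mulr_sumr; apply: eq_bigr => v _; ring.
rewrite big_split /= -mulr_suml expect1 mul1r; congr (_ + _).
rewrite -mulr_sumr -mulrN; congr (_ * _); rewrite exchange_big -sumrN.
apply: eq_bigr => u uS; rewrite exchange_big -sumrN big_mkcondr.
apply: eq_bigr => v vS; rewrite /pair_slack.
case: eqVneq => [_|vu] /=; first by rewrite oppr0.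
rewrite big_split /= -!mulr_sumr big_split /= !expect_mem // expect_mem2 //.
rewrite /slack /ecost /elp /cut_coef /join_coef /lp_edge /ind.
by case: (pos u v) => /=; ring.
Qed.

(** [alpha] times the remaining LP value is a potential: averaged over the pivot, its drop pays for
    each step. *)
Lemma pivot_ecost_le k (S : {set V}) : pivot_ecost pos x k S <= alpha R * lp_on S.
Proof.
have a0 : 0 <= alpha R by rewrite divr_ge0 ?ler0n.
elim: k S => [|k IH] S /=; first by rewrite mulr_ge0 ?lp_on_ge0.
case: (set_0Vmem S) => [->|[w0 w0S]]; first by rewrite eqxx mulr_ge0 ?lp_on_ge0.
have S0 : (0 : R) < #|S|%:R by rewrite ltr0n; apply/card_gt0P; exists w0.
rewrite ifF; last by apply/negbTE/set0Pn; exists w0.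
rewrite mulrC ler_pdivrMr //.
apply: (@le_trans _ _ (\sum_(w in S) (alpha R * lp_on S
  - 2^-1 * \sum_(u in S) \sum_(v in S) pair_slack w u v))).
  apply: ler_sum => w wS; rewrite -expected_step //; apply: ler_sum => C CS.
  apply: ler_wpM2l; last by rewrite lerD2l.
  apply: prodr_ge0 => u _; have /andP[? ?] := p_bnd w u.
  by case: ifP; rewrite ?subr_ge0.
rewrite big_split /= sumr_const sumrN -mulr_sumr.
rewrite -[X in X - _]mulr_natr gerDl oppr_le0.
by rewrite mulr_ge0 ?invr_ge0 ?ler0n ?sum_pair_slack_ge0.
Qed.
End Pivot.

(** * The LP lower bound and the approximation ratio *)

Lemma partition_lp (R : realType) (V : finType) (pos : rel V) (x : V -> V -> R)
  (P : {set {set V}}) : lp_optimal pos x -> lp_obj pos x <= cc_cost R pos P.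
Proof.
(* The 0/1 distance separating blocks is a feasible point whose objective is the cost. *)
move=> [_ opt]; pose y u v : R := ind R (pblock P u != pblock P v).
have -> : cc_cost R pos P = lp_obj pos y.
  congr (_ * _); apply: eq_bigr => u _; apply: eq_bigr => v _.
  by rewrite /y /ind; case: eqP; rewrite /= ?subr0 ?subrr.
apply: opt; split; last split; last split.
- by move=> u v; rewrite /y eq_sym.
- by move=> u; rewrite /y eqxx.
- by move=> u v; rewrite /y /ind; case: ifP; rewrite ?lexx ?ler01.
- move=> u v w; rewrite /y /ind; case: (eqVneq (pblock P u) (pblock P v)) => [->|_].
    by rewrite /= add0r.
  case: ifP => _; case: ifP => _; rewrite ?addr0 ?lexx ?ler01 ?addr_ge0 ?ler01 //.
  by rewrite lerDl ler01.
Qed.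

Theorem theorem2 (R : realType) :
  exists eps : R, 0 < eps /\ eps < 1 / 100%:R /\
  forall (V : finType) (pos : rel V) (x : V -> V -> R),
    symmetric pos ->
    lp_optimal (R:=R) pos x ->
    forall P : {set {set V}}, partition P [set: V] ->
      pivot_expected_cost (R:=R) pos x <= (206%:R / 100%:R - eps) * cc_cost R pos P.
Proof.
(* Chosen so that 2.06 - eps = 2.059 = [alpha]. *)
exists (1000%:R)^-1; split; first by rewrite invr_gt0 ltr0n.
split; first by rewrite mul1r ltf_pV2 ?posrE ?ltr0n // ltr_nat.
move=> V pos x pos_sym x_opt P _.
have -> : 206%:R / 100%:R - 1000%:R^-1 = alpha R by rewrite /alpha; field.
have x_feas := x_opt.1.
apply: le_trans (pivot_ecost_le pos_sym x_feas _ _) _.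
rewrite ler_wpM2l ?divr_ge0 ?ler0n //; apply: le_trans (partition_lp P x_opt).
rewrite le_eqVlt; apply/orP; left; apply/eqP; congr (_ * _).
apply: eq_big => [u|u _]; first by rewrite inE.
by apply: eq_bigl => v; rewrite inE.
Qed.
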